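(* Consider a two-player quantum zero-sum game as described in the context, and run the Optimistic Matrix Mirror Prox (OMMP) method with a regularizer $h$ that is $\mu$-strongly convex with respect to a norm $\|\cdot\|$ on the joint space, and with constant step size $\eta=\mu/(2\gamma)$, where $\gamma$ is a Lipschitz constant of the game operator $F$ with respect to $(\|\cdot\|,\|\cdot\|_* )$, i.e. $\|F(Z)-F(Z')\|_*\le\gamma\|Z-Z'\|$ for all joint states $Z,Z'$. Then the average iterate $\bar\Psi_N=\frac1N\sum_{t}\Psi_t$ of OMMP is an $\epsilon$-Nash equilibrium after $N=O_d(1/\epsilon)$ iterations, where the constant hidden in $O_d(\cdot)$ depends on the dimensions of the game (and on $h$) but not on $\epsilon$.
   Context: Game: Alice prepares an $n$-qubit mixed state $\alpha\in\mathcal{A}=\{\alpha\in\mathbb{C}^{2^n\times 2^n}:\alpha\succeq 0,\ \operatorname{Tr}\alpha=1\}$ and Bob an $m$-qubit mixed state $\beta\in\mathcal{B}=\{\beta\in\mathbb{C}^{2^m\times 2^m}:\beta\succeq0,\ \operatorname{Tr}\beta=1\}$ (no shared entanglement). A referee performs a POVM $\{P_\omega\}_{\omega\in\Omega}$ on $n+m$ qubits with finite outcome set $\Omega$, and $u:\Omega\to[-1,1]$ is Alice's utility. The payoff observable is $U=\sum_{\omega}u(\omega)P_\omega$ and Alice's expected payoff is $u(\alpha,\beta)=\operatorname{Tr}[U(\alpha\otimes\beta)]$; Alice maximizes it and Bob minimizes it. Joint states are pairs $\Psi=(\alpha,\beta)\in\mathcal{C}=\mathcal{A}\oplus\mathcal{B}$,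 with inner product $\langle(A_1,B_1),(A_2,B_2)\rangle=\operatorname{Tr}(A_1A_2)+\operatorname{Tr}(B_1B_2)$. The game operator is $F(\alpha,\beta)=(F_{\mathcal A}(\beta),F_{\mathcal B}(\alpha))$ with $F_{\mathcal A}(\beta)=\operatorname{Tr}_{\mathcal B}[U^\dagger(I\otimes\beta)]$ and $F_{\mathcal B}(\alpha)=-\operatorname{Tr}_{\mathcal A}[U^\dagger(\alpha\otimes I)]$ (partial traces). A joint state $(\alpha',\beta')$ is an $\epsilon$-Nash equilibrium if its duality gap $\max_{\alpha\in\mathcal A}u(\alpha,\beta')-\min_{\beta\in\mathcal B}u(\alpha',\beta)$ is at most $\epsilon$. Regularizer and Bregman divergence: $h$ is a differentiable strongly convex function on each player's spectraplex (applied blockwise on $\mathcal C$), and $D_h(X\|Y)=h(X)-h(Y)-\langle X-Y,\nabla h(Y)\rangle$. The proximal map is $P^{h,\eta}(X,Y)=\arg\max_{C}\{\langle Y,C-X\rangle-\frac1\eta D_h(C\|X)\}$, taken separately over $\mathcal A$ and over $\mathcal B$ for each player's block. OMMP: initialize $\Psi_0=\hat\Psi_0=(I/2^n,I/2^m)$; for $t=0,1,2,\dots$ set $\Psi_{t+1}=P^{h,\eta}(\hat\Psi_t,F(\Psi_t))$ and $\hat\Psi_{t+1}=P^{h,\eta}(\hat\Psi_t,F(\Psi_{t+1}))$ (each player updating its own block with its own component of $F$); after $N$ rounds output the average $\bar\Psi_N=\frac1N\sum_{t=0}^{N-1}\Psi_t$. *)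

(* Defs.v *)
(* R : realType (MathComp-Analysis), complex numbers R[i]
   from mathcomp-real-closed, Kronecker product from real_closed/mxtens. *)
From HB Require Import structures.
From mathcomp Require Import all_boot all_order all_algebra.
From mathcomp Require Import reals.
From mathcomp Require Import complex mxtens.
Set Implicit Arguments.
Unset Strict Implicit.
Unset Printing Implicit Defensive.
Import Order.TTheory GRing.Theory Num.Theory.
Local Open Scope ring_scope.

Section QGame.
Variable R : realType.
Local Notation C := (R[i]).
Local Notation toC x := ((x : R)%:C)%C.

(* conjugate transpose *)
Definition adjmx (p q : nat) (A : 'M[C]_(p, q)) : 'M[C]_(q, p) :=
  map_mx (fun z : C => (z^*)%C) A^T.

Definition hermitian (d : nat) (A : 'M[C]_d) : Prop := adjmx A = A.

(* positive semidefinite: Hermitian with nonnegative (real) quadratic form;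
   the order on C is the standard partial order: 0 <= z iff z is real >= 0 *)
Definition psd (d : nat) (A : 'M[C]_d) : Prop :=
  hermitian A /\ forall v : 'cV[C]_d, 0 <= (adjmx v *m A *m v) 0 0.

(* density matrices: the spectraplex *)
Definition density (d : nat) (A : 'M[C]_d) : Prop := psd A /\ \tr A = 1.

(* partial traces on C^p (x) C^q, consistent with the indexing of tensmx *)
Definition ptraceB (p q : nat) (M : 'M[C]_(p * q)) : 'M[C]_p :=
  \matrix_(i, j) \sum_(k < q) M (mxtens_index (i, k)) (mxtens_index (j, k)).
Definition ptraceA (p q : nat) (M : 'M[C]_(p * q)) : 'M[C]_q :=
  \matrix_(i, j) \sum_(k < p) M (mxtens_index (k, i)) (mxtens_index (k, j)).

(* ---- joint space  A (+) B, n qubits for Alice and m for Bob ---- *)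
Definition joint (n m : nat) := ('M[C]_(2 ^ n) * 'M[C]_(2 ^ m))%type.

Definition jadd n m (X Y : joint n m) : joint n m := (X.1 + Y.1, X.2 + Y.2).
Definition jopp n m (X : joint n m) : joint n m := (- X.1, - X.2).
Definition jsub n m (X Y : joint n m) : joint n m := jadd X (jopp Y).
Definition jscale n m (r : R) (X : joint n m) : joint n m :=
  (toC r *: X.1, toC r *: X.2).

(* <(A1,B1),(A2,B2)> = Tr(A1 A2) + Tr(B1 B2)  (real for Hermitian arguments) *)
Definition jip n m (X Y : joint n m) : R :=
  complex.Re (\tr (X.1 *m Y.1) + \tr (X.2 *m Y.2)).

Definition jherm n m (X : joint n m) : Prop := hermitian X.1 /\ hermitian X.2.

(* joint states C = A (+) B *)
Definition jstate n m (X : joint n m) : Prop := density X.1 /\ density X.2.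

(* a norm on the joint space (as a real vector space) *)
Definition is_norm n m (nrm : joint n m -> R) : Prop :=
  [/\ forall X Y, nrm (jadd X Y) <= nrm X + nrm Y,
      forall (r : R) X, nrm (jscale r X) = `|r| * nrm X
    & forall X, nrm X = 0 -> X = (0, 0)].

(* ||Y||_* <= c, where ||Y||_* = sup { <Y, W> : W Hermitian, ||W|| <= 1 } *)
Definition dual_norm_le n m (nrm : joint n m -> R) (Y : joint n m) (c : R) :=
  forall W, jherm W -> nrm W <= 1 -> jip Y W <= c.

(* ---- the game ---- *)
Definition povm (d : nat) (Om : finType) (P : Om -> 'M[C]_d) : Prop :=
  (forall w, psd (P w)) /\ \sum_(w : Om) P w = 1%:M.

Definition payoff_obs (d : nat) (Om : finType) (P : Om -> 'M[C]_d)
  (u : Om -> R) : 'M[C]_d := \sum_(w : Om) toC (u w) *: P w.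

Section Game.
Variables (n m : nat) (Om : finType) (P : Om -> 'M[C]_(2 ^ n * 2 ^ m))
  (u : Om -> R).
Let U := payoff_obs P u.

(* Alice's expected payoff u(alpha, beta) = Tr[U (alpha (x) beta)] *)
Definition payoff (a : 'M[C]_(2 ^ n)) (b : 'M[C]_(2 ^ m)) : C :=
  \tr (U *m (a *t b)).

Definition FA (b : 'M[C]_(2 ^ m)) : 'M[C]_(2 ^ n) :=
  ptraceB (adjmx U *m (1%:M *t b)).
Definition FB (a : 'M[C]_(2 ^ n)) : 'M[C]_(2 ^ m) :=
  - ptraceA (adjmx U *m (a *t 1%:M)).
Definition gameF (Z : joint n m) : joint n m := (FA Z.2, FB Z.1).

(* epsilon-Nash equilibrium: duality gap
   max_alpha u(alpha,beta') - min_beta u(alpha',beta) <= eps *)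
Definition eps_nash (Z : joint n m) (eps : R) : Prop :=
  forall (a : 'M[C]_(2 ^ n)) (b : 'M[C]_(2 ^ m)), density a -> density b ->
    complex.Re (payoff a Z.2) - complex.Re (payoff Z.1 b) <= eps.
End Game.

(* ---- regularizer ---- *)
Definition jh n m (hA : 'M[C]_(2 ^ n) -> R) (hB : 'M[C]_(2 ^ m) -> R)
  (Z : joint n m) : R := hA Z.1 + hB Z.2.
Definition jgh n m (ghA : 'M[C]_(2 ^ n) -> 'M[C]_(2 ^ n))
  (ghB : 'M[C]_(2 ^ m) -> 'M[C]_(2 ^ m)) (Z : joint n m) : joint n m :=
  (ghA Z.1, ghB Z.2).

(* h is (Frechet) differentiable on the joint state space with gradient gh
   (w.r.t. the inner product <.,.>):
   h Y = h X + <Y - X, gh X> + o(||Y - X||) for states X, Y. *)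
Definition differentiable_on_states n m (nrm : joint n m -> R)
  (h : joint n m -> R) (gh : joint n m -> joint n m) : Prop :=
  forall X, jstate X -> forall e : R, 0 < e -> exists2 delta : R, 0 < delta &
    forall Y, jstate Y -> nrm (jsub Y X) < delta ->
      `|h Y - h X - jip (jsub Y X) (gh X)| <= e * nrm (jsub Y X).

(* mu-strong convexity of h on the joint state space w.r.t. nrm *)
Definition strongly_convex n m (nrm : joint n m -> R) (mu : R)
  (h : joint n m -> R) : Prop :=
  forall X Y, jstate X -> jstate Y -> forall t : R, 0 <= t <= 1 ->
    h (jadd (jscale t X) (jscale (1 - t) Y))
      <= t * h X + (1 - t) * h Y - mu / 2 * t * (1 - t) * nrm (jsub X Y) ^+ 2.

(* Bregman divergence D_h(X || Y) *)
Definition bregman (d : nat) (h : 'M[C]_d -> R) (gh : 'M[C]_d -> 'M[C]_d)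
  (X Y : 'M[C]_d) : R :=
  h X - h Y - complex.Re (\tr ((X - Y) *m gh Y)).

(* Cnew is (the) P^{h,eta}(X, Y) = argmax_C { <Y, C - X> - D_h(C||X)/eta }
   over the spectraplex *)
Definition is_prox (d : nat) (h : 'M[C]_d -> R) (gh : 'M[C]_d -> 'M[C]_d)
  (eta : R) (X Y Cnew : 'M[C]_d) : Prop :=
  density Cnew /\
  forall C', density C' ->
    complex.Re (\tr (Y *m (C' - X))) - bregman h gh C' X / eta
      <= complex.Re (\tr (Y *m (Cnew - X))) - bregman h gh Cnew X / eta.

(* blockwise proximal step on the joint space *)
Definition jprox n m (hA : 'M[C]_(2 ^ n) -> R) ghA (hB : 'M[C]_(2 ^ m) -> R)
  ghB (eta : R) (X Y Z : joint n m) : Prop :=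
  is_prox hA ghA eta X.1 Y.1 Z.1 /\ is_prox hB ghB eta X.2 Y.2 Z.2.

Definition maximally_mixed n m : joint n m :=
  ((toC (2 ^ n)%:R)^-1 *: 1%:M, (toC (2 ^ m)%:R)^-1 *: 1%:M).

(* Psi, Psihat form a run of OMMP with step size eta *)
Definition ommp_run n m (F : joint n m -> joint n m)
  (hA : 'M[C]_(2 ^ n) -> R) ghA (hB : 'M[C]_(2 ^ m) -> R) ghB (eta : R)
  (Psi Psih : nat -> joint n m) : Prop :=
  [/\ Psi 0%N = maximally_mixed n m, Psih 0%N = maximally_mixed n m
    & forall t : nat,
        jprox hA ghA hB ghB eta (Psih t) (F (Psi t)) (Psi t.+1) /\
        jprox hA ghA hB ghB eta (Psih t) (F (Psi t.+1)) (Psih t.+1)].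

(* average iterate (1/N) sum_{t<N} Psi_t *)
Definition avg_iterate n m (Psi : nat -> joint n m) (N : nat) : joint n m :=
  ((toC N%:R)^-1 *: \sum_(t < N) (Psi t).1,
   (toC N%:R)^-1 *: \sum_(t < N) (Psi t).2).

End QGame.

(* Main.v *)
Require Import Defs.
From HB Require Import structures.
From mathcomp Require Import all_boot all_order all_algebra.
From mathcomp Require Import reals.
From mathcomp Require Import complex mxtens.
From mathcomp Require Import ring lra.
From mathcomp Require Import all_classical topology normedtype.
Set Implicit Arguments.
Unset Strict Implicit.
Unset Printing Implicit Defensive.
Import Order.TTheory GRing.Theory Num.Theory numFieldNormedType.Exports.
Local Open Scope ring_scope.

(** With a = |z - z0|, b = |x - z0|, b' = |x' - z|, c = |z - x| for one round
    (x, z0) |-> (x', z), the first-order optimality of the two proximal steps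
    bounds eta <F z, w - z> by
      D(w, x) - D(w, x') + mu/2 (a b' - b'^2 - c^2),
    and gives b' <= a/2 because eta gamma = mu/2. Hence
    a b' <= a^2/2 <= b^2 + c^2, the error telescopes, and the regret of the
    iterates Psi_1, Psi_2, ... is at most D(w, Psi_0)/eta. The payoff being
    bilinear, the duality gap of the average is the average of the terms
    <F Psi_t, w - Psi_t>; the term t = 0, which no proximal step controls, is
    bounded by the size of the payoff. That D(., Psi_0) is bounded uses that h,
    being differentiable at every state, is continuous on the compact set of
    states. *)

(** * Functionals linear over the reals on a complex vector space *)

(** The pairing is the real part of a trace, so it commutes with real scalars only, while the joint
    space keeps its complex module structure. *)
Definition real_linear (R : realType) (V : lmodType R[i]) (f : V -> R) :=
  forall (r : R) (x y : V), f ((r%:C)%C *: x + y) = r * f x + f y.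

Section RealLinear.
Context {R : realType} {V : lmodType R[i]} {f : V -> R}.
Hypothesis f_lin : real_linear f.

Lemma real_linearD x y : f (x + y) = f x + f y.
Proof. by have := f_lin 1 x y; rewrite rmorph1 scale1r mul1r. Qed.

Lemma real_linear0 : f 0 = 0.
Proof. by have := real_linearD 0 0; rewrite addr0; lra. Qed.

Lemma real_linearZ r x : f ((r%:C)%C *: x) = r * f x.
Proof. by have := f_lin r x 0; rewrite addr0 real_linear0 addr0. Qed.

Lemma real_linearN x : f (- x) = - f x.
Proof. by have := real_linearD x (- x); rewrite subrr real_linear0; lra. Qed.

Lemma real_linearB x y : f (x - y) = f x - f y.
Proof. by rewrite real_linearD real_linearN. Qed.

Lemma real_linear_sum (I : Type) (r : seq I) (P : pred I) (F : I -> V) :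
  f (\sum_(i <- r | P i) F i) = \sum_(i <- r | P i) f (F i).
Proof. by apply: (big_morph f); [exact: real_linearD | exact: real_linear0]. Qed.

End RealLinear.

(** * Mirror prox over an abstract convex set [S] *)

Section MirrorProx.
Context {R : realType} {V : lmodType R[i]}.
Variables (S : V -> Prop) (ip : V -> V -> R) (nrm : V -> R).
Variables (h : V -> R) (g : V -> V) (mu eta : R).

Hypothesis S_conv : forall x y (t : R), S x -> S y -> 0 <= t <= 1 ->
  S ((t%:C)%C *: x + ((1 - t)%:C)%C *: y).
Hypothesis ip_lin : forall y, real_linear (ip^~ y).
Hypothesis ipC : forall x y, ip x y = ip y x.
Hypothesis nrmD : forall x y, nrm (x + y) <= nrm x + nrm y.
Hypothesis nrmZ : forall (r : R) x, nrm ((r%:C)%C *: x) = `|r| * nrm x.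

(** Only points of [S] are compared with [x], so the notion makes sense on the boundary of [S]
    too. *)
Definition differentiable_on := forall x, S x -> forall e : R, 0 < e ->
  exists2 delta : R, 0 < delta & forall y, S y -> nrm (y - x) < delta ->
    `|h y - h x - ip (y - x) (g x)| <= e * nrm (y - x).

Definition divergence x y := h x - h y - ip (x - y) (g y).

Hypothesis h_diff : differentiable_on.
Hypothesis h_sc : forall x y, S x -> S y -> forall t : R, 0 <= t <= 1 ->
  h ((t%:C)%C *: x + ((1 - t)%:C)%C *: y)
    <= t * h x + (1 - t) * h y - mu / 2 * t * (1 - t) * nrm (x - y) ^+ 2.
Hypothesis mu_gt0 : 0 < mu.
Hypothesis eta_gt0 : 0 < eta.

Lemma nrm0 : nrm 0 = 0.
Proof. by have := nrmZ 0 0; rewrite scaler0 normr0 mul0r. Qed.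

Lemma nrmN x : nrm (- x) = nrm x.
Proof. by have := nrmZ (-1) x; rewrite rmorphN1 scaleN1r normrN1 mul1r. Qed.

(** Nonnegativity is not among the axioms; it follows from applying the triangle inequality to
    [x - x]. *)
Lemma nrm_ge0 x : 0 <= nrm x.
Proof. by have := nrmD x (- x); rewrite subrr nrm0 nrmN; lra. Qed.

Lemma nrm_distC x y : nrm (x - y) = nrm (y - x).
Proof. by rewrite -nrmN opprB. Qed.

Lemma segment_sub (x y : V) (t : R) :
  (t%:C)%C *: x + ((1 - t)%:C)%C *: y - y = (t%:C)%C *: (x - y).
Proof.
by rewrite rmorphB rmorph1 scalerBl scale1r scalerBr -!addrA [y + _]addrC subrK.
Qed.

Lemma ipDr x y z : ip x (y + z) = ip x y + ip x z.
Proof. by rewrite ipC (real_linearD (ip_lin _)) ipC (ipC z). Qed.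

Lemma ipBr x y z : ip x (y - z) = ip x y - ip x z.
Proof. by rewrite ipC (real_linearB (ip_lin _)) ipC (ipC z). Qed.

Lemma ipBl x y z : ip (x - y) z = ip x z - ip y z.
Proof. exact: (real_linearB (ip_lin _)). Qed.

Lemma ipZl r x z : ip ((r%:C)%C *: x) z = r * ip x z.
Proof. exact: (real_linearZ (ip_lin _)). Qed.

Lemma directional_derivative x y (e : R) : S x -> S y -> 0 < e ->
  exists2 t0 : R, 0 < t0 <= 1 & forall t : R, 0 < t <= t0 ->
    `|h ((t%:C)%C *: x + ((1 - t)%:C)%C *: y) - h y - t * ip (x - y) (g y)|
      <= t * e.
Proof.
move=> Sx Sy e0; have n0 := nrm_ge0 (x - y).
have n1 : 0 < nrm (x - y) + 1 by lra.
(* The added 1 keeps the tolerance meaningful when [x = y]. *)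
have [d d0 hd] := h_diff Sy (divr_gt0 e0 n1).
exists (Num.min 1 (d / (nrm (x - y) + 1))).
  by rewrite lt_min ltr01 divr_gt0 //= ge_min lexx.
move=> t /andP[t0]; rewrite le_min => /andP[t1]; rewrite ler_pdivlMr // => td.
have := hd ((t%:C)%C *: x + ((1 - t)%:C)%C *: y) _ _.
rewrite segment_sub nrmZ gtr0_norm // ipZl => H.
apply: le_trans (H _ _) _.
- by apply: S_conv => //; rewrite t1 ltW.
- by nra.
rewrite mulrCA ler_pM2l // -mulrA ler_piMr ?(ltW e0) //.
by rewrite mulrC ler_pdivrMr // mul1r; lra.
Qed.

(** Strong convexity along the segment from [y] to [x] is compared with the directional derivative
    at [y], divided by [t], and [t] tends to 0; the limit is replaced by a slack [e]. *)
Lemma divergence_ge x y : S x -> S y ->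
  mu / 2 * nrm (x - y) ^+ 2 <= divergence x y.
Proof.
move=> Sx Sy; apply/ler_addgt0Pr => e e0.
have e2 : 0 < e / 2 by lra.
have [t0 /andP[t00 t01] ht] := directional_derivative Sx Sy e2.
set n2 := nrm (x - y) ^+ 2; have n20 : 0 <= n2 by rewrite sqr_ge0.
have m0 : 0 < mu * n2 + 1 by have := mulr_ge0 (ltW mu_gt0) n20; lra.
(* Half of the slack pays for the derivative error, the other half for the term [mu / 2 * t * n2]
   left over from the factor [1 - t]. *)
pose t := Num.min t0 (e / (mu * n2 + 1)).
have tp : 0 < t by rewrite lt_min t00 divr_gt0.
have tt0 : t <= t0 by rewrite ge_min lexx.
have te : t * (mu * n2 + 1) <= e.
  by rewrite -ler_pdivlMr // ge_min lexx orbT.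
have := ht t; rewrite tp tt0 => /(_ isT); rewrite ler_norml => /andP[H1 _].
have := h_sc Sx Sy (t := t); rewrite -/n2 ltW //= (le_trans tt0) // => /(_ isT) H2.
rewrite -(ler_pM2l tp) /divergence.
have : mu / 2 * t * n2 <= e / 2 by lra.
move=> /(ler_wpM2l (ltW tp)); lra.
Qed.

Definition maximizes_prox x y z := S z /\ forall c, S c ->
  ip y (c - x) - divergence c x / eta <= ip y (z - x) - divergence z x / eta.

(** Moving from the maximizer [z] towards [c] cannot increase the objective, so [eta * ip y (c - z)
    <= ip (c - z) (g z - g x)]; the right-hand side is the stated combination of divergences. *)
Lemma prox_three_point x y z c : maximizes_prox x y z -> S c ->
  eta * ip y (c - z) <= divergence c x - divergence c z - divergence z x.
Proof.
move=> [Sz zmax] Sc; apply/ler_addgt0Pr => e e0.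
have [t /andP[t0 t1] ht] := directional_derivative Sc Sz e0.
have := ht t; rewrite t0 lexx => /(_ isT); rewrite ler_norml => /andP[_ H1].
have Sw : S ((t%:C)%C *: c + ((1 - t)%:C)%C *: z).
  by apply: S_conv => //; rewrite t1 ltW.
have sw := segment_sub c z t.
move: (_ + _) Sw sw H1 => w Sw sw H1.
have := zmax _ Sw; rewrite -(ler_pM2l eta_gt0) !mulrBr ![eta * (_ / _)]mulrCA.
rewrite divff ?gt_eqF // !mulr1 => H2.
have ew a : ip a w = ip a z + t * ip a (c - z).
  by rewrite -{1}(subrK z w) sw [LHS]ipDr [LHS]addrC [X in _ + X = _]ipC ipZl
    (ipC a (c - z)).
have ew' a : ip w a = ip z a + t * ip (c - z) a by rewrite ipC ew !(ipC a).
rewrite -(ler_pM2l t0); move: H1 H2; rewrite /divergence.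
rewrite !ipBr !ipBl !ew !ew' !ipBr !ipBl.
lra.
Qed.

(** In use, [y0] is the operator at the previous iterate [z0] and [y] the operator at [z]. The last
    hypothesis merges the Lipschitz bound, duality and the choice of step size. *)
Lemma mirror_prox_step y0 y x z0 z x' c :
  S x -> S z0 -> S c ->
  maximizes_prox x y0 z -> maximizes_prox x y x' ->
  eta * ip (y - y0) (x' - z) <= mu / 2 * (nrm (z - z0) * nrm (x' - z)) ->
  eta * ip y (c - z) + mu / 2 * nrm (x' - z) ^+ 2
    <= divergence c x - divergence c x' + mu / 2 * nrm (x - z0) ^+ 2.
Proof.
move=> Sx Sz0 Sc pz px' lip; have [Sz _] := pz; have [Sx' _] := px'.
have P1 := prox_three_point pz Sx'.
have P2 := prox_three_point px' Sc.
have P3 := prox_three_point px' Sz.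
have D1 := divergence_ge Sx' Sz.
have D2 := divergence_ge Sz Sx'; rewrite nrm_distC in D2.
have D3 := divergence_ge Sz Sx.
have tri : nrm (z - z0) <= nrm (z - x) + nrm (x - z0).
  by rewrite -[z - z0](subrKA x) nrmD.
have c0 := nrm_ge0 (z - x); have b0 := nrm_ge0 (x - z0).
have a0 := nrm_ge0 (z - z0); have b'0 := nrm_ge0 (x' - z).
move: P1 P2 P3 lip; rewrite !ipBr !ipBl => P1 P2 P3 lip.
move: (nrm (x' - z)) (nrm (z - x)) (nrm (x - z0)) (nrm (z - z0)) tri c0 b0 a0 b'0
  lip D1 D2 D3 => b' cc b a tri c0 b0 a0 b'0 lip D1 D2 D3.
(* Adding [P1] and [P3] bounds the symmetrized divergence of [x'] and [z] by [mu / 2 * (a * b')],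
   while [D1] and [D2] bound it below by [mu * b' ^+ 2]. *)
have hb : b' * (b' * 2 - a) <= 0.
  by rewrite -(pmulr_rle0 _ mu_gt0); lra.
have {}hb : b' * 2 <= a.
  rewrite leNgt; apply/negP => ab.
  have : 0 < b' * (b' * 2 - a) by apply: mulr_gt0; lra.
  lra.
(* This is [a * b' <= a ^+ 2 / 2], then the triangle inequality and
   [(b + cc) ^+ 2 <= 2 * (b ^+ 2 + cc ^+ 2)]. *)
have key : a * b' <= b ^+ 2 + cc ^+ 2.
  have h1 : 0 <= a * (a - b' * 2) by apply: mulr_ge0; lra.
  have h2 : a * a <= (cc + b) * (cc + b) by apply: ler_pM.
  have h3 := sqr_ge0 (b - cc); lra.
have := ler_wpM2l (ltW mu_gt0) key; lra.
Qed.

Variables (F : V -> V) (z x : nat -> V).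

Lemma mirror_prox_regret c N :
  S c -> S (x 0%N) -> x 0%N = z 0%N ->
  (forall t, maximizes_prox (x t) (F (z t)) (z t.+1)) ->
  (forall t, maximizes_prox (x t) (F (z t.+1)) (x t.+1)) ->
  (forall u v w w', S u -> S v -> S w -> S w' ->
     eta * ip (F u - F v) (w - w') <= mu / 2 * (nrm (u - v) * nrm (w - w'))) ->
  eta * \sum_(t < N) ip (F (z t.+1)) (c - z t.+1) <= divergence c (x 0%N).
Proof.
move=> Sc Sx0 xz0 pz px lip.
have Sx t : S (x t) by case: t => // t; case: (px t).
have Sz t : S (z t) by case: t => [|t]; [rewrite -xz0 | case: (pz t)].
(* The square kept on the left cancels the positive square produced by the next round; it vanishes
   at the start because [x 0 = z 0]. *)
suff : eta * \sum_(t < N) ip (F (z t.+1)) (c - z t.+1)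
    + mu / 2 * nrm (x N - z N) ^+ 2 <= divergence c (x 0%N) - divergence c (x N).
  have := divergence_ge Sc (Sx N).
  have := mulr_ge0 (ltW mu_gt0) (sqr_ge0 (nrm (x N - z N))).
  have := mulr_ge0 (ltW mu_gt0) (sqr_ge0 (nrm (c - x N))).
  lra.
elim: N => [|N IHN]; first by rewrite big_ord0 xz0 !subrr nrm0 expr0n /=; lra.
have := mirror_prox_step (Sx N) (Sz N) Sc (pz N) (px N)
  (lip _ _ _ _ (Sz _) (Sz _) (Sx _) (Sz _)).
by rewrite big_ord_recr /=; lra.
Qed.

End MirrorProx.

(** * Boundedness of a differentiable function on a compact set, through real coordinates *)

Section Compactness.
Local Open Scope classical_set_scope.
Context {R : realType} {V : lmodType R[i]}.
Variables (I : finType) (E : I -> V).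

(** [V] carries no topology; the row vectors of real coefficients supply one, with the sup norm and
    compact closed balls. *)
Definition combination (v : 'rV[R]_#|I|) : V :=
  \sum_(i : I) ((v 0 (enum_rank i))%:C)%C *: E i.

Lemma combinationB v w : combination (v - w) = combination v - combination w.
Proof.
rewrite /combination -sumrB; apply: eq_bigr => i _.
by rewrite !mxE rmorphB scalerBl.
Qed.

Lemma normr_coord_le n (v : 'rV[R]_n) j : `|v 0 j| <= `|v|.
Proof.
by rewrite [leRHS]/Num.norm /= mx_normrE; apply/bigmax_geP; right => /=; exists (0, j).
Qed.

Lemma real_linear_combination_le (f : V -> R) v : real_linear f ->
  `|f (combination v)| <= `|v| * \sum_(i : I) `|f (E i)|.
Proof.
move=> fl; rewrite (real_linear_sum fl) mulr_sumr.
apply: le_trans (ler_norm_sum _ _ _) _; apply: ler_sum => i _.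
by rewrite (real_linearZ fl) normrM ler_wpM2r // normr_coord_le.
Qed.

Lemma seminorm_combination_le (nrm : V -> R) v :
  (forall x y, nrm (x + y) <= nrm x + nrm y) ->
  (forall (r : R) x, nrm ((r%:C)%C *: x) = `|r| * nrm x) ->
  nrm (combination v) <= `|v| * \sum_(i : I) nrm (E i).
Proof.
move=> nD nZ; rewrite mulr_sumr /combination.
have n0 : nrm 0 = 0 by have := nZ 0 0; rewrite scaler0 normr0 mul0r.
elim/big_ind2: _ => [|x1 x2 y1 y2 h1 h2|i _]; first by rewrite n0.
  by apply: le_trans (nD _ _) (lerD h1 h2).
by rewrite nZ ler_wpM2r ?normr_coord_le // (nrm_ge0 nD nZ).
Qed.

Lemma real_linear_combination_continuous (f : V -> R) :
  real_linear f -> continuous (f \o combination).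
Proof.
move=> fl v; apply/(@cvgrPdist_le _ _ _ _ (nbhs_filter v)) => e e0 /=.
set L := \sum_(i : I) `|f (E i)|.
have L0 : 0 <= L by apply: sumr_ge0.
have L1 : 0 < L + 1 by lra.
near=> w.
rewrite -(real_linearB fl) -combinationB.
apply: le_trans (real_linear_combination_le _ fl) _; rewrite -/L.
have : `|v - w| <= e / (L + 1).
  by near: w; apply: cvgr_dist_le => //; exact: divr_gt0.
by rewrite ler_pdivlMr // mulrDr mulr1; have := normr_ge0 (v - w); lra.
Unshelve. all: by end_near.
Qed.

(* For convex S this says that S is closed, without a topology on V. *)
Definition halfspace_closed (S : V -> Prop) := forall x,
  (forall (f : V -> R) (c : R), real_linear f -> (forall y, S y -> c <= f y) ->
     c <= f x) -> S x.

(** The preimage is an intersection of closed half-spaces, each cut out by a continuous real-linear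
    function of the coefficients. *)
Lemma closed_combination_preimage (S : V -> Prop) :
  halfspace_closed S -> closed [set v | S (combination v)].
Proof.
move=> hS.
rewrite (_ : [set v | _] = \bigcap_(fc in
   [set fc : (V -> R) * R | real_linear fc.1 /\ forall y, S y -> fc.2 <= fc.1 y])
   ((fc.1 \o combination) @^-1` [set r | fc.2 <= r])).
  apply: closed_bigI => -[f c] [/= fl _].
  apply: preimage_closed => //.
  by move=> v _; exact: real_linear_combination_continuous.
apply/seteqP; split => v /= Sv; first by move=> [f c] [_ /=]; exact.
by apply: hS => f c fl fS; apply: (Sv (f, c)).
Qed.

(** Differentiability makes [h] continuous along [combination] on the compact set [K] of
    coefficients, and [K] reaches every point of [S]. *)
Lemma differentiable_bounded_above (S : V -> Prop) (ip : V -> V -> R)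
    (nrm h : V -> R) (g : V -> V) (B : R) :
  (forall y, real_linear (ip^~ y)) ->
  (forall x y, nrm (x + y) <= nrm x + nrm y) ->
  (forall (r : R) x, nrm ((r%:C)%C *: x) = `|r| * nrm x) ->
  halfspace_closed S ->
  (forall x, S x -> exists2 v, x = combination v & `|v| <= B) ->
  differentiable_on S ip nrm h g ->
  exists M, forall x, S x -> h x <= M.
Proof.
move=> ipl nD nZ hS span hd.
set K := [set v | S (combination v)] `&` [set v | `|v| <= B].
have Kc : compact K.
  apply: bounded_closed_compact.
    exists B; split; first exact: num_real.
    by move=> M BM v [_ /= vB]; apply: le_trans vB (ltW BM).
  apply: closedI; first exact: closed_combination_preimage.
  have := @preimage_closed 'rV[R]_#|I| R Num.norm [set r | r <= B].
  by apply; [move=> v _; exact: norm_continuous | exact: closed_le].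
have Kcont : {within K, continuous (h \o combination)}.
  apply/subspace_continuousP => v [/= Sv _]; apply/cvgrPdist_le => e e0 /=.
  (* Tolerance 1 suffices for continuity: near [v], [h] varies by at most [(L1 + L2) * |w - v|]. *)
  have [d d0 hv] := hd _ Sv _ ltr01.
  set L1 := \sum_(i : I) `|ip (E i) (g (combination v))|.
  set L2 := \sum_(i : I) nrm (E i).
  have L10 : 0 <= L1 by apply: sumr_ge0.
  have L20 : 0 <= L2 by apply: sumr_ge0 => i _; exact: (nrm_ge0 nD nZ).
  have Lp : 0 < L1 + L2 + 1 by lra.
  near=> w.
  have [Sw _] : K w by near: w; exact: withinT.
  (* The bound by [d] brings [w] into the range of differentiability, the bound by [e] gives the
     final estimate. *)
  have : `|v - w| < Num.min e d / (L1 + L2 + 1).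
    near: w; apply: (@cvgr_dist_lt _ _ _ (within K (nbhs v))).
      exact: cvg_within.
    by apply: divr_gt0 => //; rewrite lt_min e0.
  rewrite distrC ltr_pdivlMr // lt_min => /andP[we wd].
  have nw := seminorm_combination_le (w - v) nD nZ; rewrite -/L2 in nw.
  have iw := real_linear_combination_le (w - v) (ipl (g (combination v))).
  rewrite -/L1 in iw.
  have w0 := normr_ge0 (w - v).
  have wL1 := mulr_ge0 w0 L10; have wL2 := mulr_ge0 w0 L20.
  have := hv _ Sw; rewrite -combinationB mul1r => /(_ _)/wrap[|H].
    by apply: le_lt_trans nw _; lra.
  rewrite /= distrC -[X in `|X|](subrK
    (ip (combination (w - v)) (g (combination v)))).
  by apply: le_trans (ler_normD _ _) _; lra.
have [M [_ HM]] := compact_bounded (continuous_compact Kcont Kc).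
(* [HM] applies only to numbers strictly above [M]. *)
exists (M + 1) => x Sx; have [v xv vB] := span x Sx.
apply: le_trans (ler_norm _) _; apply: (HM (M + 1)); first by rewrite ltrDl.
by exists v; rewrite ?xv //; split => //=; rewrite -xv.
Unshelve. all: by end_near.
Qed.

End Compactness.

(** * Real and imaginary parts *)

Section ComplexParts.
Context {R : realType}.
Implicit Types (z w : R[i]) (r : R).

Lemma Re_real_linear r z w :
  complex.Re ((r%:C)%C * z + w) = r * complex.Re z + complex.Re w.
Proof. by case: z w => a b [c d] /=; rewrite mul0r subr0. Qed.

Lemma Im_real_linear r z w :
  complex.Im ((r%:C)%C * z + w) = r * complex.Im z + complex.Im w.
Proof. by case: z w => a b [c d] /=; rewrite mul0r addr0. Qed.

Lemma normr_Im_le z : (`|complex.Im z|%:C)%C <= `|z|.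
Proof. by rewrite normc_def lecR -sqrtr_sqr ler_wsqrtr // lerDr sqr_ge0. Qed.

End ComplexParts.

(** * Positive semidefinite and density matrices *)

Section Density.
Context {R : realType}.

Lemma adjmxD p q (A B : 'M[R[i]]_(p, q)) : adjmx (A + B) = adjmx A + adjmx B.
Proof. by rewrite /adjmx linearD /= map_mxD. Qed.

Lemma adjmxZ p q z (A : 'M[R[i]]_(p, q)) : adjmx (z *: A) = conjc z *: adjmx A.
Proof. by rewrite /adjmx linearZ /= map_mxZ. Qed.

Lemma adjmx1 d : adjmx 1%:M = 1%:M :> 'M[R[i]]_d.
Proof. by rewrite /adjmx trmx1 map_mx1. Qed.

Lemma adjmx_delta p q i j : adjmx (delta_mx i j : 'M[R[i]]_(p, q)) = delta_mx j i.
Proof. by rewrite /adjmx trmx_delta map_delta_mx. Qed.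

Lemma hermitianE d (A : 'M[R[i]]_d) i j : Defs.hermitian A -> A i j = conjc (A j i).
Proof. by move=> {1}<-; rewrite !mxE. Qed.

Lemma hermitianB d (A B : 'M[R[i]]_d) :
  Defs.hermitian A -> Defs.hermitian B -> Defs.hermitian (A - B).
Proof.
rewrite /Defs.hermitian => hA hB.
by rewrite -scaleN1r adjmxD adjmxZ hA hB rmorphN1.
Qed.

Lemma hermitianZ d (r : R) (A : 'M[R[i]]_d) :
  Defs.hermitian A -> Defs.hermitian ((r%:C)%C *: A).
Proof. by rewrite /Defs.hermitian adjmxZ conjc_real => ->. Qed.

Lemma psdD d (A B : 'M[R[i]]_d) : psd A -> psd B -> psd (A + B).
Proof.
move=> [hA pA] [hB pB]; split=> [|v]; first by rewrite /Defs.hermitian adjmxD hA hB.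
by rewrite mulmxDr mulmxDl mxE addr_ge0.
Qed.

Lemma psdZ d (r : R) (A : 'M[R[i]]_d) : 0 <= r -> psd A -> psd ((r%:C)%C *: A).
Proof.
move=> r0 [hA pA]; split=> [|v]; first exact: hermitianZ.
by rewrite -scalemxAr -scalemxAl mxE mulr_ge0 ?ler0c.
Qed.

Lemma psd1 d : psd (1%:M : 'M[R[i]]_d).
Proof.
split=> [|v]; first exact: adjmx1.
rewrite mulmx1 mxE sumr_ge0 // => i _.
by rewrite !mxE mulrC mulcJ_ge0.
Qed.

Lemma psd_diag_ge0 d (A : 'M[R[i]]_d) i : psd A -> 0 <= A i i.
Proof.
move=> [_ /(_ (delta_mx i 0))].
by rewrite adjmx_delta -rowE -colE !mxE.
Qed.

(** The quadratic form at [e_i + z e_j], with [z] of modulus 1 chosen so that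
    [z * A i j = - |A i j|], equals [A i i + A j j - 2 |A i j|]. *)
Lemma psd_entry_le d (A : 'M[R[i]]_d) i j :
  psd A -> `|A i j| *+ 2 <= A i i + A j j.
Proof.
move=> pA; have [A0|A0] := eqVneq (A i j) 0.
  by rewrite A0 normr0 mul0rn addr_ge0 ?psd_diag_ge0.
have [hA qA] := pA.
have n0 : `|A i j| != 0 by rewrite normr_eq0.
pose z := - conjc (A i j) / `|A i j|.
have zA : z * A i j = - `|A i j|.
  by rewrite /z mulrAC mulNr [conjc _ * _]mulrC -sqr_normc expr2 mulNr mulfK.
have zAc : conjc z * A j i = - `|A i j|.
  by rewrite (hermitianE j i hA) -rmorphM zA rmorphN /= oppr0.
have zz : z * conjc z = 1.
  rewrite -sqr_normc /z normrM normrN normcJ normfV normr_id divff //.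
  by rewrite expr1n.
have := qA (delta_mx i 0 + z *: delta_mx j 0).
rewrite adjmxD adjmxZ !adjmx_delta !mulmxDl !mulmxDr -!scalemxAl -!scalemxAr.
rewrite -!rowE -!colE !mxE zA zAc mulrA [_ * z]mulrC zz mul1r => h.
by rewrite -subr_ge0 (le_trans h) // le_eqVlt; apply/orP; left; apply/eqP; ring.
Qed.

Lemma density_entry_le1 d (A : 'M[R[i]]_d) i j : density A -> `|A i j| <= 1.
Proof.
move=> [pA tA].
have dA k : A k k <= 1.
  rewrite -tA /mxtrace (bigD1 k) //= lerDl sumr_ge0 // => l _.
  exact: psd_diag_ge0.
rewrite -(ler_pMn2r (n := 2)) //; apply: le_trans (psd_entry_le i j pA) _.
by rewrite mulr2n lerD.
Qed.

Lemma density_convex d (A B : 'M[R[i]]_d) (t : R) :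
  density A -> density B -> 0 <= t <= 1 ->
  density ((t%:C)%C *: A + ((1 - t)%:C)%C *: B).
Proof.
move=> [pA tA] [pB tB] /andP[t0 t1]; split.
  by apply: psdD; apply: psdZ; rewrite ?subr_ge0.
rewrite mxtraceD !mxtraceZ tA tB !mulr1 -rmorphD /=.
by rewrite addrC subrK.
Qed.

Lemma density_maximally_mixed d : (0 < d)%N ->
  density (((d%:R : R)%:C)%C^-1 *: (1%:M : 'M[R[i]]_d)).
Proof.
move=> d0; split.
  by rewrite -fmorphV; apply: psdZ; [rewrite invr_ge0 ler0n | exact: psd1].
by rewrite mxtraceZ mxtrace1 rmorph_nat mulVf // pnatr_eq0 -lt0n.
Qed.

(** Hermitian symmetry and unit trace are real-linear equations in the entries; positivity asks, for
    each vector, for a zero imaginary part and a nonnegative real part of the quadratic form. *)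
Lemma density_halfspace_closed d : halfspace_closed (@density R d).
Proof.
move=> A hA.
(* An equation is the pair of half-spaces given by [f] and [- f]. *)
have hE (f : 'M_d -> R) c : real_linear f ->
    (forall B : 'M_d, density B -> f B = c) -> f A = c.
  move=> fl fc; apply/eqP; rewrite eq_le; apply/andP; split.
    rewrite -lerN2; apply: (hA (fun B => - f B)) => [r x y|B /fc -> //].
    by rewrite fl opprD mulrN.
  by apply: hA => // B /fc ->.
have entry_lin (r : R) (x y : 'M[R[i]]_d) i j :
  ((r%:C)%C *: x + y) i j = (r%:C)%C * x i j + y i j by rewrite !mxE.
have quad_lin (v : 'cV[R[i]]_d) (r : R) (x y : 'M[R[i]]_d) :
    (adjmx v *m ((r%:C)%C *: x + y) *m v) 0 0 =
    (r%:C)%C * (adjmx v *m x *m v) 0 0 + (adjmx v *m y *m v) 0 0.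
  by rewrite mulmxDr mulmxDl -scalemxAr -scalemxAl !mxE.
split; first split.
- apply/matrixP => i j; rewrite !mxE; apply/eqP; rewrite eq_complex.
  have reE : complex.Re (A j i) - complex.Re (A i j) = 0.
    apply: (hE (fun B => complex.Re (B j i) - complex.Re (B i j)))
      => [r x y|B [[hB _] _]].
      by rewrite !entry_lin !Re_real_linear; ring.
    by rewrite (hermitianE i j hB); case: (B j i) => a b /=; rewrite subrr.
  have imE : complex.Im (A j i) + complex.Im (A i j) = 0.
    apply: (hE (fun B => complex.Im (B j i) + complex.Im (B i j)))
      => [r x y|B [[hB _] _]].
      by rewrite !entry_lin !Im_real_linear; ring.
    by rewrite (hermitianE i j hB); case: (B j i) => a b /=; rewrite subrr.
  by move: reE imE; case: (A j i) (A i j) => a b [a' b'] /=; lra.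
- move=> v; rewrite lecE; apply/andP; split.
    apply/eqP; apply: (hE (fun B => complex.Im ((adjmx v *m B *m v) 0 0)))
      => [r x y|B].
      by rewrite quad_lin Im_real_linear.
    by move=> [[_ /(_ v)]]; rewrite lecE => /andP[/eqP].
  apply: (hA (fun B => complex.Re ((adjmx v *m B *m v) 0 0))) => [r x y|B].
    by rewrite quad_lin Re_real_linear.
  by move=> [[_ /(_ v)]]; rewrite lecE => /andP[].
apply/eqP; rewrite eq_complex; apply/andP; split; apply/eqP.
  apply: (hE (fun B => complex.Re (\tr B))) => [r x y|B [_ ->] //].
  by rewrite mxtraceD mxtraceZ Re_real_linear.
apply: (hE (fun B => complex.Im (\tr B))) => [r x y|B [_ ->] //].
by rewrite mxtraceD mxtraceZ Im_real_linear.
Qed.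

End Density.

(** * Partial traces as adjoints of tensoring with the identity *)

Section PartialTrace.
Context {R : realType}.

Lemma sum_mxtens (p q : nat) (F : 'I_(p * q) -> R[i]) :
  \sum_x F x = \sum_i \sum_k F (mxtens_index (i, k)).
Proof.
rewrite pair_bigA /= (reindex (@mxtens_index p q)) /=.
  by apply: eq_bigr => -[].
by exists (@mxtens_unindex p q) => x _; rewrite (mxtens_indexK, mxtens_unindexK).
Qed.

Lemma trace_ptraceB (p q : nat) (M : 'M[R[i]]_(p * q)) (a : 'M_p) :
  \tr (ptraceB M *m a) = \tr (M *m (a *t 1%:M)).
Proof.
rewrite /mxtrace sum_mxtens; apply: eq_bigr => i _.
rewrite mxE (eq_bigr (fun j =>
    \sum_k M (mxtens_index (i, k)) (mxtens_index (j, k)) * a j i)).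
  rewrite exchange_big /=; apply: eq_bigr => k _.
  rewrite mxE sum_mxtens; apply: eq_bigr => j _.
  rewrite (bigD1 k) //= big1 ?addr0 => [|l lk].
    by rewrite tensmxE mxE eqxx mulr1.
  by rewrite tensmxE mxE (negbTE lk) !mulr0.
by move=> j _; rewrite mxE mulr_suml.
Qed.

Lemma trace_ptraceA (p q : nat) (M : 'M[R[i]]_(p * q)) (b : 'M_q) :
  \tr (ptraceA M *m b) = \tr (M *m (1%:M *t b)).
Proof.
rewrite /mxtrace sum_mxtens exchange_big; apply: eq_bigr => i _.
rewrite mxE (eq_bigr (fun j =>
    \sum_k M (mxtens_index (k, i)) (mxtens_index (k, j)) * b j i)).
  rewrite exchange_big /=; apply: eq_bigr => k _.
  rewrite mxE sum_mxtens exchange_big; apply: eq_bigr => j _.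
  rewrite (bigD1 k) //= big1 ?addr0 => [|l lk].
    by rewrite tensmxE mxE eqxx mul1r.
  by rewrite tensmxE mxE (negbTE lk) mul0r mulr0.
by move=> j _; rewrite mxE mulr_suml.
Qed.

End PartialTrace.

(** * The payoff and the game operator *)

Section Payoff.
Context {R : realType} (n m : nat) (Om : finType).
Variables (P : Om -> 'M[R[i]]_(2 ^ n * 2 ^ m)) (u : Om -> R).
Hypothesis P_povm : povm P.

Lemma adjmx_sum d (I : Type) (r : seq I) (F : I -> 'M[R[i]]_d) :
  adjmx (\sum_(i <- r) F i) = \sum_(i <- r) adjmx (F i).
Proof.
apply: (big_morph (@adjmx R d d)); first exact: adjmxD.
by rewrite -(scale0r 1%:M) adjmxZ conjc0 !scale0r.
Qed.

Lemma adjmx_payoff_obs : adjmx (payoff_obs P u) = payoff_obs P u.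
Proof.
have [psdP _] := P_povm; rewrite /payoff_obs adjmx_sum; apply: eq_bigr => w _.
by have [hP _] := psdP w; apply: hermitianZ.
Qed.

Lemma payoff_FA a b : payoff P u a b = \tr (FA P u b *m a).
Proof.
by rewrite /FA trace_ptraceB adjmx_payoff_obs -mulmxA tensmx_mul mul1mx mulmx1.
Qed.

Lemma payoff_FB a b : payoff P u a b = - \tr (FB P u a *m b).
Proof.
rewrite /FB mulNmx raddfN /= opprK trace_ptraceA adjmx_payoff_obs -mulmxA.
by rewrite tensmx_mul mul1mx mulmx1.
Qed.

(** The zero-sum structure cancels the two terms at [Z] itself, so the pairing bounded by the regret
    is exactly a duality gap term. *)
Lemma jip_gameF (Z : joint R n m) a b :
  jip (gameF P u Z) (jsub (a, b) Z) =
  complex.Re (payoff P u a Z.2) - complex.Re (payoff P u Z.1 b).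
Proof.
have e : \tr (FA P u Z.2 *m Z.1) = - \tr (FB P u Z.1 *m Z.2).
  by rewrite -payoff_FA payoff_FB.
rewrite payoff_FA (payoff_FB Z.1 b) /jip /= !mulmxBr !raddfB /= e.
by move: (\tr _) (\tr _) (\tr _) => [x x'] [y y'] [z z'] /=; ring.
Qed.

Hypothesis u_bound : forall w, -1 <= u w <= 1.

(** Entries of each [P w] are dominated by its diagonal entries, and the diagonals sum to 1 over the
    outcomes. *)
Lemma payoff_obs_entry_le i j : `|payoff_obs P u i j| <= 2.
Proof.
have [psdP sumP] := P_povm.
have sumPE k l : \sum_w P w k l = (1%:M : 'M[R[i]]_(2 ^ n * 2 ^ m)) k l.
  by rewrite -sumP summxE.
have -> : 2 = \sum_w (P w i i + P w j j) :> R[i].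
  by rewrite big_split /= !sumPE !mxE !eqxx.
rewrite summxE; apply: le_trans (ler_norm_sum _ _ _) _; apply: ler_sum => w _.
rewrite mxE normrM.
have u1 : `|((u w)%:C)%C| <= 1.
  by rewrite normc_def /= expr0n addr0 sqrtr_sqr lecR ler_norml.
apply: le_trans (ler_piMl _ u1) _ => //.
apply: le_trans (psd_entry_le _ _ (psdP w)).
by rewrite mulr2n lerDl.
Qed.

(** The trace has [(2 ^ n * 2 ^ m) ^ 2] terms of modulus at most 2. The bound depends on the
    dimensions only, not on the game. *)
Lemma Re_payoff_le a b : density a -> density b ->
  `|complex.Re (payoff P u a b)| <= 2 * ((2 ^ n * 2 ^ m) ^ 2)%:R.
Proof.
move=> da db; rewrite -lecR; apply: le_trans (normc_ge_Re _) _.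
rewrite /payoff /mxtrace.
apply: (@le_trans _ _ (\sum_(i < 2 ^ n * 2 ^ m) \sum_(j < 2 ^ n * 2 ^ m) 2)).
  apply: le_trans (ler_norm_sum _ _ _) _; apply: ler_sum => i _.
  rewrite mxE; apply: le_trans (ler_norm_sum _ _ _) _; apply: ler_sum => j _.
  rewrite normrM -[leRHS]mulr1; apply: ler_pM => //.
    exact: payoff_obs_entry_le.
  case: (mxtens_indexP j) => j1 j2; case: (mxtens_indexP i) => i1 i2.
  rewrite tensmxE normrM -[leRHS]mulr1.
  by apply: ler_pM => //; exact: density_entry_le1.
rewrite !sumr_const !card_ord -mulrnA -mulnn -[leLHS]mulr_natr.
by rewrite [leRHS](rmorphM (real_complex R)) !(rmorph_nat (real_complex R)).
Qed.

End Payoff.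

(** * Joint states: convexity, real coordinates, duality and proximal steps *)

Section JointStates.
Context {R : realType} (n m : nat).
Local Notation J := (('M[R[i]]_(2 ^ n) * 'M[R[i]]_(2 ^ m))%type).

Lemma jip_real_linear (Y : J) : real_linear (fun X : J => jip X Y).
Proof.
move=> r X X'; rewrite /jip /= !mulmxDl -!scalemxAl !mxtraceD !mxtraceZ.
by rewrite -Re_real_linear mulrDr addrACA.
Qed.

Lemma jipC (X Y : joint R n m) : jip X Y = jip Y X.
Proof. by rewrite /jip mxtrace_mulC [\tr (X.2 *m _)]mxtrace_mulC. Qed.

Lemma jstate_convex (X Y : J) (t : R) : jstate X -> jstate Y -> 0 <= t <= 1 ->
  jstate ((t%:C)%C *: X + ((1 - t)%:C)%C *: Y).
Proof. by move=> [X1 X2] [Y1 Y2] t01; split; apply: density_convex. Qed.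

Lemma jstate_maximally_mixed : jstate (maximally_mixed R n m).
Proof. by split; apply: density_maximally_mixed; rewrite expn_gt0. Qed.

Lemma jstate_halfspace_closed :
  halfspace_closed (fun X : J => jstate (X : joint R n m)).
Proof.
move=> X hX; split; apply: density_halfspace_closed => f c fl fS.
  apply: (hX (fun Y => f Y.1)) => [r Y Z|Y [Y1 _]]; [exact: fl | exact: fS].
apply: (hX (fun Y => f Y.2)) => [r Y Z|Y [_ Y2]]; [exact: fl | exact: fS].
Qed.

(** Indices of a real basis of both blocks: a matrix unit, with the boolean [true] marking its
    multiple by the imaginary unit. *)
Definition joint_index : finType :=
  (('I_(2 ^ n) * 'I_(2 ^ n) + 'I_(2 ^ m) * 'I_(2 ^ m)) * bool)%type.

Definition joint_basis (k : joint_index) : J :=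
  let z : R[i] := if k.2 then 'i%C else 1 in
  match k.1 with
  | inl p => (z *: delta_mx p.1 p.2, 0)
  | inr p => (0, z *: delta_mx p.1 p.2)
  end.

Definition joint_coord (X : J) (k : joint_index) : R :=
  let z := match k.1 with inl p => X.1 p.1 p.2 | inr p => X.2 p.1 p.2 end in
  if k.2 then complex.Im z else complex.Re z.

(** The imaginary part stands first to match [big_bool], which lists [true] before [false]. *)
Lemma complex_parts_scale (V : lmodType R[i]) (z : R[i]) (x : V) :
  ((complex.Im z)%:C)%C *: ('i%C *: x) + ((complex.Re z)%:C)%C *: x = z *: x.
Proof. by rewrite scalerA -scalerDl addrC [in RHS](complexE z) [X in _ + X]mulrC. Qed.

Lemma joint_basis_span (X : J) : jstate (X : joint R n m) ->
  exists2 v, X = combination joint_basis v & `|v| <= 1.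
Proof.
move=> [X1 X2]; exists (\row_j joint_coord X (enum_val j)).
  rewrite /combination.
  rewrite (eq_bigr (fun k => ((joint_coord X k)%:C)%C *: joint_basis k));
    last first.
    by move=> k _; rewrite mxE enum_rankK.
  rewrite -(pair_bigA _ (fun s b =>
    ((joint_coord X (s, b))%:C)%C *: joint_basis (s, b))) /=.
  rewrite big_sumType /=.
  rewrite (eq_bigr (fun p => (X.1 p.1 p.2 *: delta_mx p.1 p.2, 0) : J));
    last first.
    move=> p _; rewrite big_bool /joint_coord /joint_basis /= scale1r.
    by apply: injective_projections; rewrite /=
      ?complex_parts_scale // !scaler0 addr0.
  rewrite [X in _ = _ + X](eq_bigr (fun p =>
    (0, X.2 p.1 p.2 *: delta_mx p.1 p.2) : J)); last first.
    move=> p _; rewrite big_bool /joint_coord /joint_basis /= scale1r.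
    by apply: injective_projections; rewrite /=
      ?complex_parts_scale // !scaler0 addr0.
  (* Each block embedding is pulled out of its sum, so that [matrix_sum_delta] rebuilds the
     matrix. *)
  rewrite -(big_morph (fun A => (A, 0) : J)
    (id1 := 0) (op1 := +%R) (id2 := 0) (op2 := +%R)) //; last first.
    by move=> A B; apply: injective_projections; rewrite /= ?addr0.
  rewrite -(big_morph (fun B => (0, B) : J)
    (id1 := 0) (op1 := +%R) (id2 := 0) (op2 := +%R)) //; last first.
    by move=> A B; apply: injective_projections; rewrite /= ?addr0.
  rewrite -!(pair_bigA _ (fun i j => _ i j *: delta_mx i j)) /= -!matrix_sum_delta.
  by apply: injective_projections; rewrite /= ?addr0 ?add0r.
rewrite [leLHS]/Num.norm /= mx_normrE; apply/bigmax_leP; split=> // -[i j] _ /=.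
rewrite mxE; case: (enum_val j) => -[p|p] [] /=; rewrite /joint_coord /= -lecR.
- by apply: le_trans (normr_Im_le _) _; exact: density_entry_le1.
- by apply: le_trans (normc_ge_Re _) _; exact: density_entry_le1.
- by apply: le_trans (normr_Im_le _) _; exact: density_entry_le1.
- by apply: le_trans (normc_ge_Re _) _; exact: density_entry_le1.
Qed.

(** The dual bound speaks of Hermitian directions in the unit ball, so [W] is normalized; when its
    norm is 0, definiteness gives [W = 0]. *)
Lemma dual_norm_le_pairing (nrm : joint R n m -> R) Y c X X' : is_norm nrm ->
  0 <= c -> dual_norm_le nrm Y c -> jherm X -> jherm X' ->
  jip Y (jsub X X') <= c * nrm (jsub X X').
Proof.
move=> [nD nZ n0] c0 hY [hX1 hX2] [hX1' hX2'].
set W := jsub X X'.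
have nW : 0 <= nrm W := @nrm_ge0 _ J nrm nD nZ W.
have [/n0 W0|W0] := eqVneq (nrm W) 0.
  by rewrite W0 /jip /= !mulmx0 !mxtrace0 addr0 mulr_ge0 // -W0.
have Wp : 0 < nrm W by rewrite lt_def W0.
have := hY (jscale (nrm W)^-1 W).
rewrite nZ ger0_norm ?invr_ge0 // mulVf //.
have -> : jip Y (jscale (nrm W)^-1 W) = (nrm W)^-1 * jip Y W.
  by rewrite jipC (real_linearZ (jip_real_linear Y) (nrm W)^-1 (W : J)) jipC.
rewrite mulrC ler_pdivrMr //; apply => //; split; apply: hermitianZ;
  exact: hermitianB.
Qed.

(** The joint objective is the sum of the two block objectives, so blockwise maximizers maximize
    it. *)
Lemma jprox_maximizes (hA : 'M[R[i]]_(2 ^ n) -> R) ghA hB ghB eta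
    (X Y Z : joint R n m) :
  jprox hA ghA hB ghB eta X Y Z ->
  maximizes_prox (fun X : J => jstate (X : joint R n m))
    (fun X Y : J => jip (X : joint R n m) Y) (jh hA hB) (jgh ghA ghB) eta X Y Z.
Proof.
have divE (C : J) : divergence (fun X Y : J => jip (X : joint R n m) Y)
    (jh hA hB) (jgh ghA ghB) C X =
    bregman hA ghA C.1 X.1 + bregman hB ghB C.2 X.2.
  rewrite /divergence /bregman /jh /jip /jgh /=.
  by move: (\tr _) (\tr _) => [x x'] [y y'] /=; ring.
move=> [[dA mA] [dB mB]]; split=> // C [/mA + /mB].
rewrite !divE /jip /=.
have ReD (z w : R[i]) : complex.Re (z + w) = complex.Re z + complex.Re w.
  by case: z w => ? ? [].
by rewrite !ReD !mulrDl; lra.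
Qed.

End JointStates.

(** * Bounded divergence and the gap of the average iterate *)

Section Convergence.
Context {R : realType} (n m : nat).
Local Notation J := (('M[R[i]]_(2 ^ n) * 'M[R[i]]_(2 ^ m))%type).
Local Notation S := (fun X : J => jstate (X : joint R n m)).
Local Notation ip := (fun X Y : J => jip (X : joint R n m) (Y : joint R n m)).

(** As a function of [X], the divergence is [h] plus an affine term, hence differentiable with
    gradient [g X - g Z0] and the same remainder as [h]. *)
Lemma divergence_bounded_above (nrm : joint R n m -> R) h g (Z0 : J) :
  is_norm nrm -> differentiable_on_states nrm h g ->
  exists M, forall X : J, S X -> divergence ip h g X Z0 <= M.
Proof.
move=> [nD nZ _] hd.
apply: (@differentiable_bounded_above _ J _ (@joint_basis R n m) S ip nrm
  (fun X => divergence ip h g X Z0) (fun X => g X - g Z0) 1).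
- exact: jip_real_linear.
- exact: nD.
- exact: nZ.
- exact: jstate_halfspace_closed.
- exact: joint_basis_span.
move=> X SX e e0; have [d d0 hX] := hd X SX e e0.
exists d => // Y SY Yd; apply: le_trans (hX Y SY Yd).
rewrite le_eqVlt; apply/orP; left; apply/eqP; congr (`| _ |).
rewrite /divergence -[jsub Y X]/(Y - X).
rewrite (ipBr (@jip_real_linear R n m) (@jipC R n m)).
rewrite !(real_linearB (jip_real_linear _)); ring.
Qed.

Lemma Re_trace_avg d (A : 'M[R[i]]_d) (N : nat) (F : nat -> 'M[R[i]]_d) :
  (0 < N)%N ->
  complex.Re (\tr (A *m (((N%:R : R)%:C)%C^-1 *: \sum_(t < N) F t))) =
  N%:R^-1 * \sum_(t < N) complex.Re (\tr (A *m F t)).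
Proof.
move=> N0; rewrite -scalemxAr mxtraceZ mulmx_sumr raddf_sum /= -fmorphV.
have RZ (r : R) (z : R[i]) : complex.Re ((r%:C)%C * z) = r * complex.Re z.
  by case: z => x y /=; rewrite mul0r subr0.
rewrite RZ; congr (_ * _).
by elim/big_ind2: _ => // x z y w <- <-; case: z w => p q [].
Qed.

Lemma gap_avg_iterate (Om : finType) (P : Om -> 'M[R[i]]_(2 ^ n * 2 ^ m))
    (u : Om -> R) (Psi : nat -> joint R n m) a b N : povm P -> (0 < N)%N ->
  complex.Re (payoff P u a (avg_iterate Psi N).2)
    - complex.Re (payoff P u (avg_iterate Psi N).1 b) =
  N%:R^-1 * \sum_(t < N) jip (gameF P u (Psi t)) (jsub (a, b) (Psi t)).
Proof.
move=> Pp N0; have ReN (z : R[i]) : complex.Re (- z) = - complex.Re z by case: z.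
rewrite payoff_FB // payoff_FA // ReN /= (Re_trace_avg _ (fun t => (Psi t).1) N0).
rewrite (Re_trace_avg _ (fun t => (Psi t).2) N0).
rewrite -mulrN -mulrBr -sumrN -sumrB; congr (_ * _); apply: eq_bigr => t _.
by rewrite jip_gameF // payoff_FB // payoff_FA // ReN.
Qed.

End Convergence.

(** * The convergence rate of OMMP *)

Theorem mainTheorem1 (R : realType) (n m : nat)
  (nrm : joint R n m -> R)
  (hA : 'M[R[i]]_(2 ^ n) -> R) (ghA : 'M[R[i]]_(2 ^ n) -> 'M[R[i]]_(2 ^ n))
  (hB : 'M[R[i]]_(2 ^ m) -> R) (ghB : 'M[R[i]]_(2 ^ m) -> 'M[R[i]]_(2 ^ m))
  (mu gamma : R) :
  is_norm nrm -> 0 < mu -> 0 < gamma ->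
  differentiable_on_states nrm (jh hA hB) (jgh ghA ghB) ->
  strongly_convex nrm mu (jh hA hB) ->
  exists K : R,
    forall (Om : finType) (P : Om -> 'M[R[i]]_(2 ^ n * 2 ^ m)) (u : Om -> R),
      povm P -> (forall w, -1 <= u w <= 1) ->
      (forall Z Z' : joint R n m, jstate Z -> jstate Z' ->
         dual_norm_le nrm (jsub (gameF P u Z) (gameF P u Z'))
                      (gamma * nrm (jsub Z Z'))) ->
      forall (eps : R), 0 < eps ->
      forall N : nat, (0 < N)%N -> K / eps <= N%:R ->
      forall Psi Psih : nat -> joint R n m,
        ommp_run (gameF P u) hA ghA hB ghB (mu / (2 * gamma)) Psi Psih ->
        eps_nash P u (avg_iterate Psi N) eps.
Proof.
move=> nN mu0 ga0 hd hsc; have [nD nZ _] := nN.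
set eta := mu / (2 * gamma); have eta0 : 0 < eta by rewrite divr_gt0 ?mulr_gt0.
(* [M] is fixed before the game, [eps] and [N] are introduced, so the final constant cannot depend
   on them. *)
have [M hM] := divergence_bounded_above (maximally_mixed R n m) nN hd.
pose B : R := 2 * ((2 ^ n * 2 ^ m) ^ 2)%:R.
(* [2 * B] pays for round 0 and [M / eta] for all later rounds. From here on the number of rounds is
   [N.+1]. *)
exists (2 * B + M / eta) => Om P u Pp u1 lip eps e0 [//|N] _ KN Psi Psih.
move=> [Psi0 Psih0 run] a b da db.
rewrite gap_avg_iterate // mulrC ler_pdivrMr ?ltr0Sn //.
apply: le_trans (_ : 2 * B + M / eta <= _); last first.
  by rewrite [leRHS]mulrC -ler_pdivrMr.
rewrite big_ord_recl; apply: lerD.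
  rewrite jip_gameF //.
  have [S1 S2] := @jstate_maximally_mixed R n m; rewrite -Psi0 in S1 S2.
  have := Re_payoff_le Pp u1 da S2; have := Re_payoff_le Pp u1 S1 db.
  by rewrite !ler_norml -/B => /andP[h1 _] /andP[_ h2]; lra.
have Sab : jstate ((a, b) : joint R n m) by [].
rewrite ler_pdivlMr // mulrC; apply: le_trans (hM _ Sab); rewrite -Psih0.
(* The iterates [z] are [Psi] and the base points [x] are [Psih]. *)
apply: (@mirror_prox_regret _ ('M[R[i]]_(2 ^ n) * 'M[R[i]]_(2 ^ m))%type
   _ _ nrm (jh hA hB) (jgh ghA ghB) mu eta _ _ _ _ _ _ _ _ _ (gameF P u)
   Psi Psih).
- exact: jstate_convex.
- exact: jip_real_linear.
- exact: jipC.
- exact: nD.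
- exact: nZ.
- exact: hd.
- exact: hsc.
- exact: mu0.
- exact: eta0.
- exact: Sab.
- by rewrite Psih0; exact: jstate_maximally_mixed.
- by rewrite Psih0 Psi0.
- by move=> t; apply: jprox_maximizes; case: (run t).
- by move=> t; apply: jprox_maximizes; case: (run t).
move=> X Y Z Z' SX SY [[[hZ1 _] _] [[hZ2 _] _]] [[[hZ1' _] _] [[hZ2' _] _]].
have nXY : 0 <= nrm (jsub X Y).
  exact: (@nrm_ge0 _ ('M[R[i]]_(2 ^ n) * 'M[R[i]]_(2 ^ m))%type nrm nD nZ).
(* The pairing is at most [gamma] times the two norms, and [eta * gamma = mu / 2]. *)
have := dual_norm_le_pairing nN (mulr_ge0 (ltW ga0) nXY) (lip _ _ SX SY)
  (conj hZ1 hZ2) (conj hZ1' hZ2').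
rewrite -(ler_pM2l eta0) => /le_trans; apply.
rewrite le_eqVlt; apply/orP; left; apply/eqP.
rewrite -[Z - Z']/(jsub Z Z') -[X - Y]/(jsub X Y) /eta; field; lra.
Qed.
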